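(* Suppose $k$ points $(X_1,\dots,X_L)$ are selected from the $L$-dimensional ball of radius $r$ centered at the origin, with $r$ unknown, and let $m_2$ be the largest observed value of the statistic $\sqrt{X_1^2+X_2^2+\cdots+X_L^2}$ among the $k$ points. Then the formula for the estimate $\widehat r$ of $r$ in terms of $m_2$, $k$ and $L$, coming from the expected value of this largest statistic, is $$\widehat r = m_2\cdot\frac{Lk+1}{Lk}.$$
   Context: Here $k, L\ge 1$ are integers and $r>0$ is real. The $k$ points are real points (not necessarily lattice points), chosen independently and uniformly from the ball $\{x\in\mathbb{R}^L : x_1^2+\cdots+x_L^2\le r^2\}$, so that the probability that the largest observed value of the statistic is at most $m_2$ is $m_2^{Lk}/r^{Lk}$ for $0\le m_2\le r$. The estimate is obtained by computing the expected value of the largest observed statistic as a function of $r$, $k$ and $L$, solving for $r$, and substituting the observed value $m_2$ for the expected value. *)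

(* Defs.v *)
From mathcomp Require Import all_boot all_order all_algebra.
From mathcomp Require Import all_classical all_reals all_analysis.

Set Implicit Arguments.
Unset Strict Implicit.
Unset Printing Implicit Defensive.

Import Order.TTheory GRing.Theory Num.Theory.
Import numFieldNormedType.Exports.

Local Open Scope classical_set_scope.
Local Open Scope ring_scope.

(* n-dimensional Lebesgue measure, as the iterated product of n copies of the
   one-dimensional one: by definition of [\x] in the library,
   (m1 \x m2) A = \int[m1]_x m2 (xsection A x). Points of R^n are n-tuples,
   whose sigma-algebra is generated by the coordinates. *)
Fixpoint lebesgue_tuple (R : realType) (n : nat) :
    set (n.-tuple R) -> \bar R :=
  match n with
  | 0 => fun A => \d_([tuple] : 0.-tuple R) A
  | m.+1 => fun A =>
      (\int[@lebesgue_measure R]_x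
         lebesgue_tuple [set t : m.-tuple R | A [tuple of x :: t]])%E
  end.

Definition norm2 (R : realType) (L : nat) (x : L.-tuple R) : R :=
  Num.sqrt (\sum_(i < L) tnth x i ^+ 2).

Definition ball2 (R : realType) (L : nat) (r : R) : set (L.-tuple R) :=
  [set x | \sum_(i < L) tnth x i ^+ 2 <= r ^+ 2].

(* The default value 0 of the iterated maximum is harmless for k >= 1, since
   norms are nonnegative. *)
Definition largest_norm (R : realType) (k L : nat) (x : 'I_k -> L.-tuple R) : R :=
  \big[Num.max/0]_(i < k) norm2 (x i).

Definition uniform_on_ball (R : realType) (L : nat) (d : measure_display)
    (Omega : measurableType d) (P : probability Omega R)
    (X : {mfun Omega >-> L.-tuple R}) (r : R) : Prop :=
  forall A : set (L.-tuple R), measurable A ->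
    distribution P X A =
      (lebesgue_tuple (A `&` ball2 r) / lebesgue_tuple (@ball2 R L r))%E.

Definition independent_points (R : realType) (k L : nat) (d : measure_display)
    (Omega : measurableType d) (P : probability Omega R)
    (X : 'I_k -> {mfun Omega >-> L.-tuple R}) : Prop :=
  forall (J : {set 'I_k}) (A : 'I_k -> set (L.-tuple R)),
    (forall i, measurable (A i)) ->
    P (\bigcap_(i in [set` J]) (X i @^-1` A i)) =
      (\prod_(i in J) P (X i @^-1` A i))%E.

(* P r is the law of the experiment when the unknown radius is r; it is
   constrained only for r > 0. *)
Definition ball_sampling (R : realType) (k L : nat) (d : measure_display)
    (Omega : measurableType d) (P : R -> probability Omega R)
    (X : 'I_k -> {mfun Omega >-> L.-tuple R}) : Prop :=
  forall r : R, 0 < r ->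
    (forall i, uniform_on_ball (P r) (X i) r) /\ independent_points (P r) X.

(* rhat is a radius for which the expected value of the largest norm among the
   k random points is the observed value m2. *)
Definition radius_estimate (R : realType) (k L : nat) (d : measure_display)
    (Omega : measurableType d) (P : R -> probability Omega R)
    (X : 'I_k -> {mfun Omega >-> L.-tuple R}) (m2 rhat : R) : Prop :=
  0 < rhat /\
  'E_(P rhat)[fun w => largest_norm (fun i => X i w)]%E = m2%:E.

(* Main.v *)
Require Import Defs.
From mathcomp Require Import all_boot all_order all_algebra.
From mathcomp Require Import all_classical all_reals all_analysis.
From mathcomp Require Import measurable_realfun ring.

Set Implicit Arguments.
Unset Strict Implicit.
Unset Printing Implicit Defensive.

Import Order.TTheory GRing.Theory Num.Theory.
Import numFieldNormedType.Exports.

Local Open Scope classical_set_scope.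
Local Open Scope ring_scope.

(** If X is uniform on the ball of radius r, the ball of radius t <= r has
    probability (t / r) ^ L, because the volume of a ball is proportional to the
    L-th power of its radius. The largest of k independent norms is at most t
    when all k of them are, which has probability (t / r) ^ (L k)
    ([largest_norm_cdf]). The tail formula for the expectation of a nonnegative
    random variable then gives
      E = \int_0^r (1 - (t / r) ^ (L k)) dt = r * (L k / (L k + 1))
    ([expected_largest_norm]), and solving E = m2 for r gives the estimate.

    The volume of a ball is never computed: only its scaling is needed, and it
    comes from slicing. If V_n(s) is the n-dimensional volume of the points
    whose squared norm is at most s, then V_(n+1)(s) is the integral over x of
    V_n(s - x ^ 2); the substitution x = sqrt(s) y extracts one factor sqrt(s),
    so by induction V_n(s) = V_n(1) * sqrt(s) ^ n for s >= 0
    ([lebesgue_tuple_ball_profile]). That V_n(1) is positive and finite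
    follows from uniformity itself: the total mass 1 of the law of a point is
    vol(ball) / vol(ball), a quotient that is not 1 when the volume is 0 or +oo
    ([uniform_ball2]). *)

(** * Dilations of the real line *)

Lemma lebesgue_measure_dilation (R : realType) (c : R)
    (A : set (measurableTypeR R)) : 0 < c -> measurable A ->
  lebesgue_measure A =
  (c%:E * pushforward lebesgue_measure
    ( *%R c : measurableTypeR R -> measurableTypeR R) A)%E.
Proof.
move=> c0 mA; pose k : {nonneg R} := NngNum (ltW c0).
unshelve epose (m := mscale k (pushforward lebesgue_measure
  ( *%R c : measurableTypeR R -> measurableTypeR R))
  : {measure set (measurableTypeR R) -> \bar R}).
  exact: mulrl_measurable.
apply: (@lebesgue_measure_unique R m) => // _ [[a b]] _ <-.
transitivity (c%:E * lebesgue_measure `](a / c)%R, (b / c)%R]%classic)%E;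
  last first.
  congr (_ * lebesgue_measure _)%E; apply/seteqP; split => x /=;
  by rewrite !in_itv/= ltr_pdivrMr// ler_pdivlMr// mulrC.
rewrite !lebesgue_measure_itv/= !lte_fin ltr_pM2r ?invr_gt0//.
case: ifPn => _; last by rewrite mule0.
by rewrite -!EFinB -EFinM -mulrBl mulrCA divff ?mulr1// gt_eqF.
Qed.

Lemma ge0_integral_dilation (R : realType) (c : R) (f : R -> \bar R) :
  0 < c -> measurable_fun [set: R] f -> (forall x, 0 <= f x)%E ->
  (\int[@lebesgue_measure R]_x f x =
   c%:E * \int[@lebesgue_measure R]_x f (c * x)%R)%E.
Proof.
move=> c0 mf f0; pose k : {nonneg R} := NngNum (ltW c0).
have mc : measurable_fun [set: measurableTypeR R]
    ( *%R c : _ -> measurableTypeR R) by exact: mulrl_measurable.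
rewrite -(preimage_setT ( *%R c : _ -> measurableTypeR R)).
rewrite -(ge0_integral_pushforward mc)//.
rewrite -(@ge0_integral_mscale _ _ _ _ _ _ k)//.
rewrite preimage_setT.
apply: eq_measure_integral => A mA _; exact: lebesgue_measure_dilation.
Qed.

(** * Volume of balls *)

Lemma lebesgue_tuple_ge0 (R : realType) n (A : set (n.-tuple R)) :
  (0 <= lebesgue_tuple A)%E.
Proof.
elim: n A => [|n IH] A /=; first exact: measure_ge0.
by apply: integral_ge0 => x _; exact: IH.
Qed.

(** The volume, relative to the unit ball, of the n-dimensional points whose
    squared norm is at most s. The indicator factor is there for n = 0, where
    the power of the square root is 1 even for s < 0. *)
Definition ball_profile (R : realType) (n : nat) (s : R) : R :=
  (0 <= s)%R%:R * Num.sqrt s ^+ n.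

Lemma ball_profile_ge0 (R : realType) n (s : R) : 0 <= ball_profile n s.
Proof. by rewrite mulr_ge0// exprn_ge0// sqrtr_ge0. Qed.

Lemma ball_profile_lt0 (R : realType) n (s : R) : s < 0 -> ball_profile n s = 0.
Proof. by move=> s0; rewrite /ball_profile leNgt s0 mul0r. Qed.

Lemma ball_profile_sqr (R : realType) n (r : R) :
  0 <= r -> ball_profile n (r ^+ 2) = r ^+ n.
Proof.
by move=> r0; rewrite /ball_profile sqr_ge0 mul1r sqrtr_sqr ger0_norm.
Qed.

Lemma ball_profileM (R : realType) n (s t : R) : 0 < s ->
  ball_profile n (s * t) = Num.sqrt s ^+ n * ball_profile n t.
Proof.
move=> s0; rewrite /ball_profile pmulr_rge0// sqrtrM ?(ltW s0)// exprMn.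
by rewrite mulrCA.
Qed.

Lemma measurable_ball_profile (R : realType) n :
  measurable_fun [set: R] (@ball_profile R n).
Proof.
apply: measurable_funM; last first.
  apply: measurable_funX.
  exact: (continuous_measurable_fun (@sqrt_continuous R)).
rewrite (_ : (fun s : R => _) = \1_`[0, +oo[%classic); last first.
  by apply/funext => s; rewrite indicE mem_setE in_itv/= andbT.
exact: measurable_indic.
Qed.

Lemma measurable_slice_profile (R : realType) n (s : R) :
  measurable_fun [set: R] (fun x => (ball_profile n (s - x ^+ 2))%:E).
Proof.
apply/measurable_EFinP.
apply: (measurableT_comp (@measurable_ball_profile R n)).
by apply: measurable_funB => //; exact: measurable_funX.
Qed.

(** The slicing step: for s > 0 the substitution x = sqrt(s) y turns s - x ^ 2
    into s (1 - y ^ 2), and homogeneity does the rest. *)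
Lemma integral_slice_profile (R : realType) n (s : R) :
  (\int[@lebesgue_measure R]_x (ball_profile n (s - x ^+ 2))%:E =
   (ball_profile n.+1 s)%:E *
   \int[@lebesgue_measure R]_x (ball_profile n (1 - x ^+ 2))%:E)%E.
Proof.
have [s0|s0|->] := ltgtP s 0.
- rewrite ball_profile_lt0// mul0e integral0_eq// => x _.
  by rewrite ball_profile_lt0// (le_lt_trans _ s0)// lerBlDr lerDl sqr_ge0.
- have q0 : 0 < Num.sqrt s by rewrite sqrtr_gt0.
  rewrite [LHS](ge0_integral_dilation q0); last 2 first.
  + exact: measurable_slice_profile.
  + by move=> x; rewrite lee_fin ball_profile_ge0.
  transitivity ((Num.sqrt s)%:E * \int[@lebesgue_measure R]_x
      ((Num.sqrt s ^+ n)%:E * (ball_profile n (1 - x ^+ 2))%:E))%E.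
    congr (_ * _)%E; apply: eq_integral => x _.
    by rewrite exprMn sqr_sqrtr ?ltW// -{1}(mulr1 s) -mulrBr ball_profileM.
  rewrite ge0_integralZl//; last 2 first.
  + exact: measurable_slice_profile.
  + by move=> x _; rewrite lee_fin ball_profile_ge0.
  by rewrite muleA -EFinM -exprS /ball_profile (ltW s0) mul1r.
(* The integrand vanishes off the null set {0}. *)
- rewrite /ball_profile sqrtr0 expr0n/= mulr0 mul0e.
  rewrite -(@integral_setD1 _ _ 0) => //.
  + apply: integral0_eq => x [_ /= /eqP x0].
    by rewrite sub0r oppr_ge0 leNgt exprn_even_gt0//= x0 mul0r.
  + exact: measurableD.
  + exact: measurable_funS (measurable_slice_profile n 0).
Qed.

(** The index s is the squared radius, possibly negative, so that the slices
    of a ball, of index s - x ^ 2, are covered by the induction hypothesis for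
    every x. *)
Lemma lebesgue_tuple_ball_profile (R : realType) n (s : R) :
  lebesgue_tuple [set x : n.-tuple R | \sum_(i < n) tnth x i ^+ 2 <= s] =
  (lebesgue_tuple (@ball2 R n 1) * (ball_profile n s)%:E)%E.
Proof.
rewrite /ball2 expr1n.
elim: n s => [|n IH] s.
  have mem r : ([tuple] \in
      [set x : 0.-tuple R | \sum_(i < 0) tnth x i ^+ 2 <= r]) = (0 <= r).
    by apply/idP/idP; rewrite inE /= big_ord0.
  by rewrite /= !diracE !mem ler01 mul1e /ball_profile expr0 mulr1.
have sum_cons x (t : n.-tuple R) :
    \sum_(i < n.+1) tnth [tuple of x :: t] i ^+ 2 =
    x ^+ 2 + \sum_(i < n) tnth t i ^+ 2.
  by rewrite big_ord_recl tnth0; under eq_bigr do rewrite tnthS.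
have slice r : lebesgue_tuple
    [set x : n.+1.-tuple R | \sum_(i < n.+1) tnth x i ^+ 2 <= r] =
  (lebesgue_tuple [set x : n.-tuple R | (\sum_(i < n) tnth x i ^+ 2 <= 1)%R] *
   \int[@lebesgue_measure R]_x (ball_profile n (r - x ^+ 2))%:E)%E.
  rewrite /= -ge0_integralZl//; last 3 first.
  - exact: measurable_slice_profile.
  - by move=> x _; rewrite lee_fin ball_profile_ge0.
  - exact: lebesgue_tuple_ge0.
  apply: eq_integral => x _; rewrite -IH; congr lebesgue_tuple.
  by apply/seteqP; split=> t; rewrite /mkset sum_cons lerBrDl.
rewrite !slice (integral_slice_profile n s).
by rewrite -muleA; congr (_ * _)%E; rewrite muleC.
Qed.

Lemma lebesgue_tuple_ball2 (R : realType) n (r : R) : 0 <= r ->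
  lebesgue_tuple (@ball2 R n r) =
  (lebesgue_tuple (@ball2 R n 1) * (r ^+ n)%:E)%E.
Proof.
by move=> r0; rewrite -(ball_profile_sqr n r0) -lebesgue_tuple_ball_profile.
Qed.

(** * Norms of the sampled points *)

Lemma norm2_le (R : realType) L (x : L.-tuple R) (t : R) : 0 <= t ->
  (norm2 x <= t) = (\sum_(i < L) tnth x i ^+ 2 <= t ^+ 2).
Proof.
move=> t0; rewrite -[in LHS](ger0_norm t0) -sqrtr_sqr ler_sqrt//.
exact: sqr_ge0.
Qed.

Lemma ball2E (R : realType) L (t : R) : 0 <= t ->
  @ball2 R L t = [set x | norm2 x <= t].
Proof. by move=> t0; apply/seteqP; split=> x; rewrite /mkset norm2_le. Qed.

Lemma measurable_norm2 (R : realType) L :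
  measurable_fun [set: L.-tuple R] (@norm2 R L).
Proof.
apply: (measurableT_comp (continuous_measurable_fun (@sqrt_continuous R))).
apply: measurable_sum => i; apply: measurable_funX; exact: measurable_tnth.
Qed.

Lemma measurable_ball2 (R : realType) L (t : R) : 0 <= t ->
  measurable (@ball2 R L t).
Proof.
move=> t0; rewrite ball2E// -[X in measurable X]setTI.
rewrite (_ : [set x | _] = @norm2 R L @^-1` `]-oo, t]%classic).
  exact: measurable_norm2.
by apply/seteqP; split=> x /=; rewrite in_itv.
Qed.

Lemma ball2I (R : realType) L (t r : R) : 0 <= t -> 0 <= r ->
  @ball2 R L t `&` @ball2 R L r = @ball2 R L (Num.min t r).
Proof.
move=> t0 r0; rewrite !ball2E ?le_min ?t0//.
by apply/seteqP; split=> x /=; rewrite le_min => /andP.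
Qed.

(** The minimum makes the formula valid for all t >= 0, including t > r, where
    the probability is 1. *)
Lemma uniform_ball2 (R : realType) (L : nat) (d : measure_display)
    (Omega : measurableType d) (P : probability Omega R)
    (X : {mfun Omega >-> L.-tuple R}) (r t : R) :
  0 < r -> 0 <= t -> uniform_on_ball P X r ->
  distribution P X (@ball2 R L t) = ((Num.min t r / r) ^+ L)%:E.
Proof.
move=> r0 t0 PX; have rL0 : r ^+ L != 0 by rewrite expf_neq0 ?gt_eqF.
rewrite PX; last exact: measurable_ball2.
have := PX setT measurableT.
have m0 : 0 <= Num.min t r by rewrite le_min t0 ltW.
rewrite (ball2I L t0 (ltW r0)) setTI probability_setT.
rewrite (lebesgue_tuple_ball2 L (ltW r0)) (lebesgue_tuple_ball2 L m0).
have := lebesgue_tuple_ge0 (@ball2 R L 1).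
case: (lebesgue_tuple _) => [v||]//= _.
- rewrite -!EFinM !inver mulf_eq0 (negPf rL0) orbF.
  (* The inverse of 0 is +oo, and 0 * +oo = 0 differs from 1. *)
  have [->|v0 _] := eqVneq v 0.
    by rewrite mul0r mul0e => /eqP; rewrite onee_eq0.
  by rewrite -EFinM expr_div_n; congr EFin; field; rewrite v0 rL0.
(* The inverse of +oo is 0, and +oo * 0 = 0 differs from 1. *)
- rewrite gt0_mulye; last by rewrite lte_fin exprn_gt0.
  by rewrite invey mule0 => /eqP; rewrite onee_eq0.
Qed.

Lemma largest_norm_ge0 (R : realType) k L (x : 'I_k -> L.-tuple R) :
  0 <= largest_norm x.
Proof.
rewrite /largest_norm; elim/big_rec : _ => // i y _ y0.
by rewrite le_max y0 orbT.
Qed.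

Lemma largest_norm_le (R : realType) k L (x : 'I_k -> L.-tuple R) (t : R) :
  0 <= t -> largest_norm x <= t <-> forall i, norm2 (x i) <= t.
Proof.
move=> t0; split=> [xt i|xt].
  by apply: le_trans xt; rewrite /largest_norm (bigD1 i)//= le_max lexx.
by rewrite /largest_norm; elim/big_ind : _ => // a b at_ bt; rewrite ge_max at_.
Qed.

Lemma measurable_largest_norm (R : realType) k L (d : measure_display)
    (Omega : measurableType d) (X : 'I_k -> {mfun Omega >-> L.-tuple R}) :
  measurable_fun [set: Omega] (fun w => largest_norm (fun i => X i w)).
Proof.
rewrite /largest_norm.
elim: (index_enum _) => [|i s IH].
  by under eq_fun do rewrite big_nil; exact: measurable_cst.
under eq_fun do rewrite big_cons.
apply: measurable_maxr => //.
exact: (measurableT_comp (@measurable_norm2 R L)).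
Qed.

(** * Law and expectation of the largest norm *)

Lemma largest_norm_cdf (R : realType) (k L : nat) (d : measure_display)
    (Omega : measurableType d) (P : probability Omega R)
    (X : 'I_k -> {mfun Omega >-> L.-tuple R}) (r t : R) :
  0 < r -> 0 <= t ->
  (forall i, uniform_on_ball P (X i) r) -> independent_points P X ->
  P [set w | largest_norm (fun i => X i w) <= t] =
    ((Num.min t r / r) ^+ (L * k))%:E.
Proof.
move=> r0 t0 uX iX.
have -> : [set w | largest_norm (fun i => X i w) <= t] =
    \bigcap_(i in [set` [set: 'I_k]%SET]) (X i @^-1` @ball2 R L t).
  rewrite ball2E//; apply/seteqP; split=> w /=.
    by move/(largest_norm_le _ t0) => wt i _; exact: wt.
  by move=> wt; apply/(largest_norm_le _ t0) => i; apply: wt; rewrite /= inE.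
rewrite iX; last by move=> _; exact: measurable_ball2.
under eq_bigr => i _ do
  rewrite -[P _]/(distribution P (X i) _) (uniform_ball2 r0 t0 (uX i)).
rewrite -[LHS]/(\prod_(i in [set: 'I_k]%SET) ((Num.min t r / r) ^+ L)%:E)%E.
rewrite prodEFin; congr EFin.
by rewrite prodr_const cardsT card_ord exprM.
Qed.

Lemma integral_ccdf_power (R : realType) (r : R) (N : nat) : 0 < r ->
  (\int[@lebesgue_measure R]_(t in `[0%R, +oo[)
    (1 - (Num.min t r / r) ^+ N)%:E = (r * (N%:R / N.+1%:R))%:E)%E.
Proof.
move=> r0.
transitivity (\int[@lebesgue_measure R]_(t in `[0%R, r])
    (1 - (t / r) ^+ N)%:E)%E.
  rewrite integral_mkcond [RHS]integral_mkcond; apply: eq_integral => t _.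
  rewrite !patchE !mem_setE !in_itv/= andbT.
  have [t0|//] := leP 0 t; have [tr//|rt] := leP t r.
  by rewrite divff ?gt_eqF// expr1n subrr.
(* f is the integrand and F its antiderivative, written with the operations of
   the algebra of functions so that derivatives are inferred. *)
pose f : R -> R := cst 1 - (r^-1 *: @id R) ^+ N.
pose F : R -> R := @id R - (r / N.+1%:R) *: (r^-1 *: @id R) ^+ N.+1.
have fE t : 1 - (t / r) ^+ N = f t by rewrite /f !fctE/= mulrC.
have FE t : F t = t - r / N.+1%:R * (t / r) ^+ N.+1.
  by rewrite /F !fctE/= [t / r]mulrC.
have N1 : N.+1%:R != 0 :> R by rewrite pnatr_eq0.
have rn0 : r != 0 by rewrite gt_eqF.
have dF (t : R) : is_derive t (1 : R) F (f t).
  apply: is_derive_eq; rewrite /f !fctE/= /GRing.scale/= mulr1.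
  by field; rewrite rn0 nat1r.
have cont (g : R -> R) : (forall t : R, derivable g t 1) -> continuous g.
  by move=> dg t; exact/differentiable_continuous/derivable1_diffP/dg.
have cF : continuous F by apply: cont => t; exact: ex_derive.
under eq_integral => t _ do rewrite fE.
rewrite (@continuous_FTC2 _ _ F)//.
- rewrite -EFinB !FE; congr EFin.
  rewrite mul0r expr0n/= mulr0 subr0 subr0 divff// expr1n mulr1.
  by field; rewrite nat1r.
- by apply/continuous_subspaceT/cont => t; exact: ex_derive.
- split; [|exact/cvg_at_right_filter/cF|exact/cvg_at_left_filter/cF].
  by move=> *; exact: ex_derive.
- by move=> t _; rewrite derive1E derive_val.
Qed.

Lemma expected_largest_norm (R : realType) (k L : nat) (d : measure_display)
    (Omega : measurableType d) (P : probability Omega R)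
    (X : 'I_k -> {mfun Omega >-> L.-tuple R}) (r : R) :
  0 < r ->
  (forall i, uniform_on_ball P (X i) r) -> independent_points P X ->
  ('E_P[fun w => largest_norm (fun i => X i w)] =
    (r * ((L * k)%:R / ((L * k)%:R + 1)))%:E)%E.
Proof.
move=> r0 uX iX.
pose M : {mfun Omega >-> R} := mfun_Sub (mem_set (measurable_largest_norm X)).
rewrite -[LHS]/('E_P[M])%E ge0_expectation_ccdf; last first.
  by move=> w; exact: largest_norm_ge0.
rewrite natr1 -integral_ccdf_power//.
apply: eq_integral => t; rewrite inE/= in_itv/= andbT => t0.
rewrite ccdf_1_cdf EFinB -(largest_norm_cdf r0 t0 uX iX).
by congr (1 - P _)%E.
Qed.

Theorem mainTheorem6 (R : realType) (k L : nat)
    (k_ge1 : (1 <= k)%N) (L_ge1 : (1 <= L)%N)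
    (d : measure_display) (Omega : measurableType d)
    (P : R -> probability Omega R)
    (X : 'I_k -> {mfun Omega >-> L.-tuple R})
    (PX : ball_sampling P X)
    (x : 'I_k -> L.-tuple R) (m2 : R)
    (m2E : m2 = largest_norm x) (m2_gt0 : 0 < m2) (rhat : R) :
  radius_estimate P X m2 rhat <->
  rhat = m2 * (((L * k)%:R + 1) / (L * k)%:R).
Proof.
have N0 : 0 < (L * k)%:R :> R by rewrite ltr0n muln_gt0 L_ge1.
have N1 : 0 < (L * k)%:R + 1 :> R by rewrite addr_gt0.
have E r : 0 < r -> 'E_(P r)[fun w => largest_norm (fun i => X i w)]%E =
    (r * ((L * k)%:R / ((L * k)%:R + 1)))%:E.
  by move=> r0; have [uX iX] := PX r r0; exact: expected_largest_norm.
rewrite /radius_estimate; move: ((L * k)%:R) N0 N1 E => N N0 N1 E.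
split=> [[r0]|->].
- by rewrite E// => -[<-]; field; rewrite !gt_eqF.
- have r0 : 0 < m2 * ((N + 1) / N) by rewrite mulr_gt0 ?divr_gt0.
  by split=> //; rewrite E//; congr EFin; field; rewrite !gt_eqF.
Qed.
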